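(* Suppose $\mathbb{H}$ is a recurrent, infinite, connected, vertex-transitive graph of finite degree. Then the simple random walk on $\mathbb{H}$ is amnesiac, i.e. for every estimator $\Phi$, $$\limsup_{n\to\infty}\ \inf_{v\in V(\mathbb{H})}\mathbb{P}_v\big(\Phi(G_n^{\mathbb{H}})=v\big)=0.$$
   Context: $(X_n)_{n\ge0}$ is the simple random walk on $\mathbb{H}$; $\mathbb{P}_v$ is its law when started at the source $X_0=v$. $\mathbb{H}$ is recurrent if the walk returns to its starting vertex almost surely. The $n$-step trace $G_n^{\mathbb{H}}$ is the subgraph of $\mathbb{H}$ consisting of the vertices $X_0,\dots,X_n$ and the edges $\{X_i,X_{i+1}\}$, $0\le i<n$ (as an embedded graph, i.e. its actual vertex and edge sets in $\mathbb{H}$ are known). An estimator $\Phi$ is a function taking as input an embedded graph $G\subseteq\mathbb{H}$ and outputting a vertex of $\mathbb{H}$; the output may be random, conditionally on the trace (i.e. given $G$ it is drawn from a distribution depending only on $G$, independently of the walk otherwise). *)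

(* Defs.v *)
From HB Require Import structures.
From mathcomp Require Import all_boot all_order all_algebra finmap.
From mathcomp Require Import all_classical all_reals all_analysis.

Set Implicit Arguments.
Unset Strict Implicit.
Unset Printing Implicit Defensive.

Import Order.TTheory GRing.Theory Num.Theory.
Local Open Scope classical_set_scope.
Local Open Scope ring_scope.

(* Vertex types are pointed only because [measurableType] requires it; the
   vertex sets of interest are infinite, hence inhabited. *)

Record sgraph (V : eqType) := SGraph {
  adj :> rel V ;
  adj_sym : symmetric adj ;
  adj_irrefl : irreflexive adj }.

Section Graphs.
Variables (V : pointedType) (H : sgraph V).

Definition neighbours (x : V) : set V := [set y | H x y].

Definition finite_degree : Prop := forall x, finite_set (neighbours x).

(* Meaningful when [neighbours x] is finite: [fset_set] is empty otherwise. *)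
Definition degree (x : V) : nat := #|` fset_set (neighbours x)|%fset.

Definition connected_graph : Prop :=
  forall x y : V, exists p : seq V, path H x p /\ last x p = y.

Definition automorphism (f : V -> V) : Prop :=
  bijective f /\ {mono f : x y / H x y}.

Definition vertex_transitive : Prop :=
  forall x y : V, exists f : V -> V, automorphism f /\ f x = y.

End Graphs.

(* [V] equipped with the sigma-algebra of all its subsets. *)
Definition discrete_space (V : pointedType) : Type := V.

HB.instance Definition _ (V : pointedType) :=
  Pointed.on (discrete_space V).

HB.instance Definition _ (V : pointedType) :=
  @isMeasurable.Build default_measure_display (discrete_space V)
    (@discrete_measurable V) (@discrete_measurable0 V)
    (@discrete_measurableC V) (@discrete_measurableU V).

(* A set of vertices and a set of edges, an edge being an unordered pair of
   vertices {x, y}. *)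
Record embedded_graph (V : Type) := EmbeddedGraph {
  vertices : set V ;
  edges : set (set V) }.

(* A randomised estimator: the conditional distribution of the guess given the
   observed graph (a Dirac mass when the guess is deterministic). The domain is
   not cut down to the subgraphs of a given graph; values elsewhere are never
   used. *)
Definition estimator (R : realType) (V : pointedType) : Type :=
  embedded_graph V -> probability (discrete_space V) R.

Section RandomWalk.
Local Open Scope ereal_scope.
Variables (R : realType) (V : pointedType) (H : sgraph V).

Definition transition (x y : V) : R :=
  if H x y then ((degree H x)%:R^-1)%R else 0%R.

Variables (d : measure_display) (Omega : measurableType d).
Variables (P : V -> probability Omega R)
          (X : nat -> {mfun Omega >-> discrete_space V}).

(* Under [P v], [X] is the Markov chain on [V] with initial state [v] and
   transition matrix [transition]. *)
Definition simple_random_walk : Prop :=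
  (forall v : V, P v [set w | X 0%N w = v] = 1) /\
  (forall (v : V) (n : nat) (x : nat -> V),
     P v [set w | forall i, (i <= n.+1)%N -> X i w = x i] =
     P v [set w | forall i, (i <= n)%N -> X i w = x i]
       * (transition (x n) (x n.+1))%:E).

Definition recurrent : Prop :=
  forall v : V, {ae P v, forall w, exists n, (0 < n)%N /\ X n w = v}.

Definition trace_graph (n : nat) (w : Omega) : embedded_graph V :=
  EmbeddedGraph
    [set (X i w : V) | i in [set i | (i <= n)%N]]
    [set ([set X i w; X i.+1 w] : set V) | i in [set i | (i < n)%N]].

(* The probability, started from [v], that the guess made from the [n]-step
   trace is [v]. Conditionally on the walk the guess has law
   [Phi (trace_graph n w)], so this is the mean of the conditional probability
   of guessing [v]. *)
Definition success_prob (Phi : estimator R V) (n : nat) (v : V) : \bar R :=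
  \int[P v]_w Phi (trace_graph n w) [set v].

Definition amnesiac : Prop :=
  forall Phi : estimator R V,
    limn_esup (fun n => ereal_inf [set success_prob Phi n v | v in [set: V]])
    = 0.

End RandomWalk.

(* Main.v *)
Require Import Defs.
From mathcomp Require Import all_boot all_order all_algebra finmap.
From mathcomp Require Import all_classical all_reals all_analysis.
From mathcomp Require Import measurable_realfun lra.
Local Open Scope classical_set_scope.

(** Two ingredients make the walk forget its source.

    The trace stops growing.  Let [c n] be the expected number of distinct
    edges among the first [n] steps; by transitivity it does not depend on the
    source.  Splitting off the first step, [c (n + 1) - c n] is the probability
    that the first edge is not crossed again in the next [n] steps
    ([mean_rangeS_first]); splitting off the last step, it is the probability
    that the last edge is new ([mean_rangeS_last]).  So these two probabilities
    are equal.  The first one tends to 0: by recurrence the walk keeps returning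
    to each vertex and has a fixed chance of crossing the edge at each return
    ([unused_cvg0]).  Hence the last edge is new with vanishing probability
    ([last_edge_new_cvg0]).

    The law of the trace is almost harmonic in the source.  Let [g] be a
    function of the trace with values in [0, 1] and [h n x] the mean of [g] on
    the [n]-step trace from [x].  Move the source to a uniform neighbour by
    deleting the first edge, then add a new last edge to restore the length.
    Unless the deleted edge is never crossed again or the added edge is new, the
    trace is unchanged, so [h n x] is at most the mean of [h n] over the
    neighbours of [x], plus an error [delta n] that tends to 0 uniformly in [g]
    and [x] ([graph_mean_subharmonic]).  Iterating this until the walk hits a
    fixed vertex [v], or for [m] steps, bounds [h n u] by [h n v], plus [m]
    times [delta n], plus the probability that the walk from [u] has not hit [v]
    by time [m] ([maximum_principle]).  The last term tends to 0 as [m] grows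
    ([miss_cvg0]), so [h n u] exceeds [h n v] by at most [eps] for large [n]
    ([graph_mean_source]).

    Finally take [K] distinct vertices.  The events that the guess is one or
    another of them are disjoint, so from a common source their probabilities
    sum to at most 1; replacing, in each term, the common source by the guessed
    vertex costs at most [eps].  So one of the [K] vertices is recovered with
    probability at most [1 / K + eps].

    All these expectations are finite averages: [walk_mean] averages over the
    neighbours step by step, and [integral_walk_mean] identifies it with the
    integral over the probability space of the walk. *)

Import Order.TTheory GRing.Theory Num.Theory.
Import numFieldNormedType.Exports.

Set Implicit Arguments.
Unset Strict Implicit.
Unset Printing Implicit Defensive.

(** * Averages over the walk *)

Section Averages.
Local Open Scope ring_scope.
Context {R : realType} {V : pointedType}.
Variable H : sgraph V.
Hypothesis hdeg : finite_degree H.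
Hypothesis hpos : forall x, exists y, H x y.

Definition nbrs (x : V) : seq V := fset_set (neighbours H x).

Lemma mem_nbrs x y : (y \in nbrs x) = H x y.
Proof.
rewrite /nbrs in_fset_set; last exact: hdeg.
by apply/idP/idP => [/set_mem|h]; [|apply/mem_set].
Qed.

Lemma nbrs_uniq x : uniq (nbrs x).
Proof. exact: fset_uniq. Qed.

Lemma degreeE x : degree H x = size (nbrs x).
Proof. by []. Qed.

Lemma degree_gt0 x : (0 < degree H x)%N.
Proof.
rewrite degreeE; have [y] := hpos x; rewrite -mem_nbrs.
by case: (nbrs x).
Qed.

Definition mean (f : V -> R) (x : V) : R :=
  (degree H x)%:R^-1 * \sum_(y <- nbrs x) f y.

Lemma le_mean f g x : (forall y, f y <= g y) -> mean f x <= mean g x.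
Proof.
move=> fg; apply: ler_wpM2l; first by rewrite invr_ge0.
by apply: ler_sum => y _.
Qed.

Lemma eq_mean f g x : f =1 g -> mean f x = mean g x.
Proof. by move=> fg; congr (_ * _); apply: eq_bigr => y _. Qed.

Lemma mean_cst c x : mean (fun=> c) x = c.
Proof.
rewrite /mean big_const_seq count_predT -degreeE iter_addr addr0.
rewrite -[c *+ _]mulr_natr mulrCA mulVf ?mulr1//.
by rewrite pnatr_eq0 -lt0n degree_gt0.
Qed.

Lemma meanD f g x : mean (fun y => f y + g y) x = mean f x + mean g x.
Proof. by rewrite /mean big_split mulrDr. Qed.

Lemma mean_sum (I : Type) (r : seq I) (F : I -> V -> R) x :
  mean (fun y => \sum_(i <- r) F i y) x = \sum_(i <- r) mean (F i) x.
Proof. by rewrite /mean exchange_big -big_distrr. Qed.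

Lemma mean_ge0 f x : (forall y, 0 <= f y) -> 0 <= mean f x.
Proof. by move=> f0; rewrite -(mean_cst 0 x); exact: le_mean. Qed.

Lemma mean_eq0 f x y :
  (forall z, 0 <= f z) -> mean f x <= 0 -> H x y -> f y = 0.
Proof.
move=> f0 mf0 xy; apply/eqP; rewrite eq_le f0 andbT.
have d0 : 0 < (degree H x)%:R :> R by rewrite ltr0n degree_gt0.
move: mf0; rewrite /mean pmulr_rle0 ?invr_gt0//; apply: le_trans.
have yx : y \in nbrs x by rewrite mem_nbrs.
by rewrite (big_rem y)//= lerDl sumr_ge0.
Qed.

Lemma cvg_mean (f : nat -> V -> R) (g : V -> R) x :
  (forall y, H x y -> f n y @[n --> \oo] --> g y) ->
  mean (f n) x @[n --> \oo] --> mean g x.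
Proof.
move=> fg; apply: cvgM; first exact: cvg_cst.
rewrite big_seq; under eq_fun do rewrite big_seq.
apply: cvg_big => [|y]; first exact: add_continuous.
by rewrite mem_nbrs; exact: fg.
Qed.

(** The expectation of [F] at the list of the first [n] vertices visited after
    the source [x]. *)
Fixpoint walk_mean (n : nat) (F : seq V -> R) (x : V) : R :=
  if n is n'.+1 then mean (fun y => walk_mean n' (fun s => F (y :: s)) y) x
  else F [::].

Lemma walk_meanS n F x :
  walk_mean n.+1 F x = mean (fun y => walk_mean n (fun s => F (y :: s)) y) x.
Proof. by []. Qed.

Lemma le_walk_mean n F G x :
  (forall s, F s <= G s) -> walk_mean n F x <= walk_mean n G x.
Proof.
elim: n F G x => [|n IHn] F G x FG /=; first exact: FG.
by apply: le_mean => y; exact: IHn.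
Qed.

Lemma eq_walk_mean n F G x : F =1 G -> walk_mean n F x = walk_mean n G x.
Proof.
by move=> FG; apply/eqP; rewrite eq_le !le_walk_mean// => s; rewrite FG.
Qed.

Lemma walk_mean_cst n c x : walk_mean n (fun=> c) x = c.
Proof.
elim: n x => //= n IHn x; rewrite -[RHS](mean_cst c x).
exact: eq_mean.
Qed.

Lemma walk_meanD n F G x :
  walk_mean n (fun s => F s + G s) x = walk_mean n F x + walk_mean n G x.
Proof.
elim: n F G x => //= n IHn F G x; rewrite -meanD.
by apply: eq_mean => y; rewrite IHn.
Qed.

Lemma walk_mean_sum (I : Type) (r : seq I) n (F : I -> seq V -> R) x :
  walk_mean n (fun s => \sum_(i <- r) F i s) x =
  \sum_(i <- r) walk_mean n (F i) x.
Proof.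
elim: n F x => //= n IHn F x; rewrite -mean_sum.
by apply: eq_mean => y; rewrite IHn.
Qed.

Lemma walk_mean_ge0 n F x : (forall s, 0 <= F s) -> 0 <= walk_mean n F x.
Proof. by move=> F0; rewrite -(walk_mean_cst n 0 x); exact: le_walk_mean. Qed.

Lemma walk_mean_le1 n F x : (forall s, F s <= 1) -> walk_mean n F x <= 1.
Proof. by move=> F1; rewrite -(walk_mean_cst n 1 x); exact: le_walk_mean. Qed.

(** The recursion above peels off the first step; this is the Markov property
    at the last step. *)
Lemma walk_meanSr n F x :
  walk_mean n.+1 F x =
  walk_mean n (fun s => mean (fun z => F (rcons s z)) (last x s)) x.
Proof.
elim: n F x => // n IHn F x.
rewrite [LHS]walk_meanS [RHS]walk_meanS; apply: eq_mean => y.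
exact: IHn.
Qed.

Lemma mean_automorphism f F x :
  automorphism H f -> mean F (f x) = mean (F \o f) x.
Proof.
move=> [bf mf].
have fnb : perm_eq (nbrs (f x)) [seq f y | y <- nbrs x].
  apply: uniq_perm; rewrite ?map_inj_uniq ?nbrs_uniq//; first exact: bij_inj.
  have [g fg gf] := bf.
  move=> y; rewrite -[y]gf (mem_map (can_inj fg)) !mem_nbrs.
  exact: mf.
by rewrite /mean !degreeE (perm_size fnb) size_map (perm_big _ fnb) big_map.
Qed.

Lemma walk_mean_automorphism f n F x :
  automorphism H f ->
  walk_mean n F (f x) = walk_mean n (fun s => F (map f s)) x.
Proof.
move=> af; elim: n F x => //= n IHn F x.
by rewrite mean_automorphism//; apply: eq_mean => y /=; rewrite IHn.
Qed.

(** * Hitting probabilities *)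

(** The tail of the hitting time of [v] for the walk from [x]. *)
Definition miss (v : V) (m : nat) (x : V) : R :=
  walk_mean m (fun s => (v \notin x :: s)%:R) x.

Lemma missS v m x :
  miss v m.+1 x = if x == v then 0 else mean (miss v m) x.
Proof.
rewrite /miss; case: eqVneq => [->|xv].
  rewrite -[RHS](walk_mean_cst m.+1 0 v); apply: eq_walk_mean => s.
  by rewrite mem_head.
apply: eq_mean => y; apply: eq_walk_mean => s.
by rewrite [in LHS]inE eq_sym (negbTE xv).
Qed.

Lemma miss_ge0 v m x : 0 <= miss v m x.
Proof. exact: walk_mean_ge0. Qed.

Lemma miss_self v m : miss v m v = 0.
Proof.
by case: m => [|m]; rewrite ?missS ?eqxx// /miss/= mem_head.
Qed.

Lemma miss_nonincreasing v x : nonincreasing_seq (miss v ^~ x).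
Proof.
apply/nonincreasing_seqP => m; elim: m x => [|m IHm] x.
  rewrite missS; case: ifP => [_|xv]; first exact: miss_ge0.
  rewrite {2}/miss /= inE eq_sym xv /= -[leRHS](mean_cst 1 x).
  by apply: le_mean => y; rewrite /miss/=; case: (_ \notin _).
rewrite [leRHS]missS missS; case: ifP => // _.
by apply: le_mean => y; exact: IHm.
Qed.

(** A function that is subharmonic up to [delta] is compared with its value at
    [v] by following the walk until it hits [v] or [m] steps have elapsed: each
    step costs [delta], and if [v] has been missed the bound 1 is used. *)
Lemma maximum_principle (f : V -> R) (delta : R) v m x :
  (forall y, 0 <= f y <= 1) -> 0 <= delta ->
  (forall y, f y <= mean f y + delta) ->
  f x <= f v + delta *+ m + miss v m x.
Proof.
move=> f01 d0 sub; elim: m x => [|m IHm] x.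
  rewrite mulr0n addr0 /miss/= inE; have [->|_] := eqVneq v x.
    by rewrite lerDl.
  by have /andP[_ fx] := f01 x; have /andP[fv _] := f01 v; rewrite /=; lra.
rewrite missS; case: eqVneq => [->|_].
  by rewrite addr0 lerDl mulrn_wge0.
apply: (le_trans (sub x)); rewrite mulrSr addrA [leRHS]addrAC lerD2r.
rewrite -[X in X + _](mean_cst (f v + delta *+ m) x) -meanD.
exact: le_mean.
Qed.

Lemma nonincreasing_ge0_cvg (u : nat -> R) :
  nonincreasing_seq u -> (forall n, 0 <= u n) -> u @ \oo --> limn u.
Proof.
move=> ud u0; apply: nonincreasing_is_cvgn => //.
by exists 0 => _ [n _ <-].
Qed.

Lemma limit_unique (u : nat -> R) (a b : R) :
  u n @[n --> \oo] --> a -> u n @[n --> \oo] --> b -> a = b.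
Proof. by apply: cvg_unique; exact: norm_hausdorff. Qed.

Lemma le_limit (u w : nat -> R) (a b : R) : (forall n, u n <= w n) ->
  u n @[n --> \oo] --> a -> w n @[n --> \oo] --> b -> a <= b.
Proof. by move=> uw ua wb; apply: (ler_cvg_to ua wb); exact: nearW. Qed.

Section Recurrent.
Hypothesis hconn : connected_graph H.
Hypothesis hret : forall v,
  walk_mean m (fun s => (v \notin s)%:R) v @[m --> \oo] --> 0.

(** The limit [r] of the missing probabilities is harmonic off [v] and vanishes
    at [v]; its mean over the neighbours of [v] is the probability of never
    returning, hence 0.  As [r] is nonnegative, wherever its mean is 0 it
    vanishes at all neighbours, and this spreads along paths from [v]. *)
Lemma miss_cvg0 v x : miss v m x @[m --> \oo] --> 0.
Proof.
pose r y := limn (miss v ^~ y).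
have rE y : miss v m y @[m --> \oo] --> r y.
  apply: nonincreasing_ge0_cvg; first exact: miss_nonincreasing.
  by move=> n; exact: miss_ge0.
have r0 y : 0 <= r y.
  apply: limr_ge; first by apply/cvg_ex; exists (r y); exact: rE.
  by apply: nearW => n; exact: miss_ge0.
have rv : r v = 0.
  apply: (@limit_unique (miss v ^~ v)) => //.
  under eq_fun do rewrite miss_self.
  exact: cvg_cst.
have mrv : mean r v = 0.
  apply: (@limit_unique (fun n => mean (miss v n) v)) => //.
    exact: cvg_mean.
  move: (hret v); rewrite -cvg_shiftS /=; apply: cvg_trans.
  apply: near_eq_cvg; apply: nearW => n; rewrite /=.
  exact: eq_mean.
have mr y : v != y -> mean r y = r y.
  move=> vy; apply: (@limit_unique (fun n => mean (miss v n) y)) => //.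
    exact: cvg_mean.
  move: (rE y); rewrite -cvg_shiftS /=; apply: cvg_trans.
  apply: near_eq_cvg; apply: nearW => n; rewrite /=.
  by rewrite missS eq_sym (negbTE vy).
have [p [pp <-]] := hconn v x.
suff <- : r (last v p) = 0 by exact: rE.
elim/last_ind: p pp => // p y IHp; rewrite rcons_path last_rcons.
move=> /andP[/IHp rp py].
apply: (mean_eq0 r0 _ py).
have [<-|vl] := eqVneq v (last v p); first by rewrite mrv.
by rewrite mr// rp.
Qed.

(** [x] and [v] are arbitrary, so this is the constancy of bounded subharmonic
    functions on a recurrent graph. *)
Lemma bounded_subharmonic_cst (f : V -> R) x v :
  (forall y, 0 <= f y <= 1) -> (forall y, f y <= mean f y) -> f x <= f v.
Proof.
move=> f01 sub; rewrite -[leRHS]addr0.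
have h : f v + miss v m x @[m --> \oo] --> f v + 0.
  by apply: cvgD; [exact: cvg_cst|exact: miss_cvg0].
apply: le_limit (cvg_cst (f x)) h => m.
rewrite -[X in X + _]addr0 -[X in _ + X + _](mul0rn _ m).
by apply: maximum_principle => // y; rewrite addr0.
Qed.

(** * Edges crossed by the walk *)

Definition trail_edges (x : V) (s : seq V) : seq (set V) :=
  pairmap (fun a b => [set a; b]) x s.

Lemma trail_edges_rcons x s y :
  trail_edges x (rcons s y) = rcons (trail_edges x s) [set last x s; y].
Proof. by elim: s x => //= z s IHs x; rewrite IHs. Qed.

Definition unused (e : set V) (n : nat) (x : V) : R :=
  walk_mean n (fun s => (e \notin trail_edges x s)%:R) x.

Lemma unused_bounds e n x : 0 <= unused e n x <= 1.
Proof.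
by rewrite walk_mean_ge0//= walk_mean_le1// => s; case: (_ \notin _).
Qed.

Lemma unused_le_mean e n x : unused e n.+1 x <= mean (unused e n) x.
Proof.
rewrite /unused walk_meanS; apply: le_mean => y; apply: le_walk_mean => s.
rewrite ler_nat /= inE negb_or.
by case: (e \in trail_edges y s); case: (_ == _).
Qed.

Lemma unused_nonincreasing e x : nonincreasing_seq (unused e ^~ x).
Proof.
apply/nonincreasing_seqP => n; rewrite /unused walk_meanSr.
apply: le_walk_mean => s; rewrite -[leRHS](mean_cst _ (last x s)).
apply: le_mean => z; rewrite ler_nat trail_edges_rcons mem_rcons inE negb_or.
by case: (e \in trail_edges x s); case: (_ == _).
Qed.

(** The limit [t] of [unused e n] is subharmonic, hence constant.  At the
    endpoint [v] of [e], one neighbour of [v] is reached through [e] and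
    contributes 0 to the average, so the constant is 0. *)
Lemma unused_cvg0 v y x : H v y -> unused [set v; y] n x @[n --> \oo] --> 0.
Proof.
move=> vy; set e := [set v; y].
pose t z := limn (unused e ^~ z).
have tE z : unused e n z @[n --> \oo] --> t z.
  apply: nonincreasing_ge0_cvg; first exact: unused_nonincreasing.
  by move=> n; have /andP[] := unused_bounds e n z.
have ct z : cvgn (unused e ^~ z) by apply/cvg_ex; exists (t z); exact: tE.
have t01 z : 0 <= t z <= 1.
  apply/andP; split; [apply: limr_ge|apply: limr_le] => //;
    by apply: nearW => n; have /andP[] := unused_bounds e n z.
have shift z : unused e n.+1 z @[n --> \oo] --> t z.
  by have := tE z; rewrite -cvg_shiftS.
have sub z : t z <= mean t z.
  apply: le_limit (shift z) (@cvg_mean (unused e) t z (fun y _ => tE y)) => n.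
  exact: unused_le_mean.
have tv z : t z <= t v by exact: bounded_subharmonic_cst.
suff tv0 : t v = 0.
  suff <- : t x = 0 by exact: tE.
  apply/eqP; rewrite eq_le -{1}tv0 tv.
  by have /andP[] := t01 x.
(* [g] is [t] with the neighbour reached through [e] switched off. *)
pose g z := if z == y then 0 else t z.
have g0 z : 0 <= t v - g z.
  rewrite subr_ge0 /g; case: ifP => // _.
  by have /andP[] := t01 v.
have tg : t v <= mean g v.
  pose h n z := if z == y then 0 else unused e n z.
  have hg z : h n z @[n --> \oo] --> g z.
    by rewrite /g /h; case: ifP => _; [exact: cvg_cst|exact: tE].
  apply: le_limit (shift v) (@cvg_mean h g v (fun z _ => hg z)) => n.
  rewrite /unused walk_meanS; apply: le_mean => z.
  rewrite /h; case: eqVneq => [->|_].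
    rewrite -[leRHS](walk_mean_cst n 0 y); apply: le_walk_mean => s.
    by rewrite /= mem_head.
  apply: le_walk_mean => s; rewrite ler_nat /= inE negb_or.
  by case: (e \in trail_edges z s); case: (_ == _).
suff : t v - g y = 0 by rewrite /g eqxx subr0.
apply: (mean_eq0 g0 _ vy).
have := mean_cst (t v) v.
rewrite -[X in mean X](_ : (fun z => (t v - g z) + g z) = _); last first.
  by apply/funext => z; rewrite subrK.
by rewrite meanD; lra.
Qed.

Hypothesis htrans : vertex_transitive H.

Definition mean_range (n : nat) (x : V) : R :=
  walk_mean n (fun s => (size (undup (trail_edges x s)))%:R) x.

Lemma trail_edges_map f x s :
  trail_edges (f x) (map f s) = [seq f @` (e : set V) | e <- trail_edges x s].
Proof.
elim: s x => //= y s IHs x; rewrite IHs; congr (_ :: _).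
by rewrite image_setU !image_set1.
Qed.

Lemma mean_range_transitive n x y : mean_range n x = mean_range n y.
Proof.
have [f [af <-]] := htrans y x.
rewrite /mean_range walk_mean_automorphism//; apply: eq_walk_mean => s.
rewrite trail_edges_map undup_map_inj ?size_map//.
have [[f' fK _] _] := af; apply: (@can_inj _ _ _ (fun A => f' @` A)) => A.
rewrite image_comp; apply/seteqP; split=> [_ [z Az <-]|z Az] /=.
  by rewrite fK.
by exists z; rewrite //= fK.
Qed.

Definition first_edge_unused (n : nat) (x : V) : R :=
  mean (fun y => unused [set x; y] n y) x.

Definition last_edge_new (n : nat) (x : V) : R :=
  walk_mean n
    (fun s => mean (fun z => ([set last x s; z] \notin trail_edges x s)%:R)
                   (last x s)) x.

Lemma size_undup_cons (T : eqType) (e : T) s :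
  (size (undup (e :: s)))%:R = (e \notin s)%:R + (size (undup s))%:R :> R.
Proof. by rewrite -natrD /=; case: (e \in s). Qed.

(** The two ways of computing the growth of the expected range; their
    comparison transfers the decay of [first_edge_unused], which recurrence
    gives, to [last_edge_new]. *)
Lemma mean_rangeS_first n x :
  mean_range n.+1 x = first_edge_unused n x + mean_range n x.
Proof.
rewrite -[X in _ + X](mean_cst _ x) -meanD /mean_range walk_meanS.
apply: eq_mean => y; rewrite -/(mean_range n x) (mean_range_transitive n x y).
by rewrite -walk_meanD; apply: eq_walk_mean => s; exact: size_undup_cons.
Qed.

Lemma mean_rangeS_last n x :
  mean_range n.+1 x = last_edge_new n x + mean_range n x.
Proof.
rewrite /mean_range walk_meanSr -walk_meanD; apply: eq_walk_mean => s.
rewrite -[X in _ + X](mean_cst _ (last x s)) -meanD; apply: eq_mean => z.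
rewrite trail_edges_rcons -size_undup_cons; congr _%:R.
apply/perm_size/perm_undup => e.
by rewrite mem_rcons.
Qed.

Lemma last_edge_new_cvg0 x : last_edge_new n x @[n --> \oo] --> 0.
Proof.
have -> : last_edge_new ^~ x = first_edge_unused ^~ x.
  apply/funext => n; apply: (addIr (mean_range n x)).
  by rewrite -mean_rangeS_first -mean_rangeS_last.
rewrite -(mean_cst 0 x); apply: cvg_mean => y xy.
exact: unused_cvg0.
Qed.

Lemma last_edge_new_transitive n x y : last_edge_new n x = last_edge_new n y.
Proof.
apply: (addIr (mean_range n x)); rewrite -mean_rangeS_last.
rewrite [mean_range n x](mean_range_transitive _ _ y) -mean_rangeS_last.
exact: mean_range_transitive.
Qed.

(** * Dependence of the trace on its source *)

Definition trail_graph (x : V) (s : seq V) : embedded_graph V :=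
  EmbeddedGraph [set` x :: s] [set` trail_edges x s].

Lemma mem_trail_edges x s e a : e \in trail_edges x s -> e a -> a \in x :: s.
Proof.
elim: s x => //= y s IHs x; rewrite inE => /predU1P[->|es ea].
  by move=> [] ->; rewrite !inE eqxx ?orbT.
by rewrite inE IHs ?orbT.
Qed.

Lemma trail_graph_cons x y s : [set x; y] \in trail_edges y s ->
  trail_graph x (y :: s) = trail_graph y s.
Proof.
move=> es; rewrite /trail_graph; congr EmbeddedGraph; apply/seteqP.
  split=> z /=; last by rewrite [in X in _ -> X]inE => ->; rewrite orbT.
  rewrite inE => /predU1P[->|//]; apply: (mem_trail_edges es).
  by left.
by split=> e /=; rewrite inE; [move=> /predU1P[->|]|move=> ->; rewrite orbT].
Qed.

Lemma trail_graph_rcons x s z : [set last x s; z] \in trail_edges x s ->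
  trail_graph x (rcons s z) = trail_graph x s.
Proof.
move=> es; rewrite /trail_graph trail_edges_rcons.
congr EmbeddedGraph; apply/seteqP.
  split=> y /=; rewrite -rcons_cons mem_rcons inE.
    move=> /predU1P[->|//]; apply: (mem_trail_edges es).
    by right.
  by move=> ->; rewrite orbT.
split=> e /=; rewrite mem_rcons inE; first by move=> /predU1P[->|].
by move=> ->; rewrite orbT.
Qed.

Definition graph_mean (g : embedded_graph V -> R) (n : nat) (x : V) : R :=
  walk_mean n (fun s => g (trail_graph x s)) x.

(** Moving the source along the first step and appending a last step changes
    the trace only if the first edge is not crossed again or the last edge is
    new; both have probability [last_edge_new n x]. *)
Lemma graph_mean_subharmonic g n x : (forall G, 0 <= g G <= 1) ->
  graph_mean g n.+1 x <= mean (graph_mean g n.+1) x + last_edge_new n x *+ 2.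
Proof.
move=> g01.
have le01 (b : bool) G G' : (~~ b -> G = G') -> g G <= g G' + b%:R.
  case: b => [_|->//]; last by rewrite addr0.
  by have /andP[_ G1] := g01 G; have /andP[G0 _] := g01 G'; rewrite /=; lra.
rewrite mulr2n addrA.
have {2}-> : last_edge_new n x = first_edge_unused n x.
  apply: (addIr (mean_range n x)).
  by rewrite -mean_rangeS_first -mean_rangeS_last.
rewrite -[X in _ + X + _](mean_cst _ x) -!meanD /graph_mean walk_meanS.
apply: le_mean => y; rewrite (last_edge_new_transitive n x y).
rewrite walk_meanSr -!walk_meanD; apply: le_walk_mean => s.
apply: (@le_trans _ _ (g (trail_graph y s) +
                       ([set x; y] \notin trail_edges y s)%:R)).
  by apply: le01 => /negPn; exact: trail_graph_cons.
rewrite lerD2r -meanD -[leLHS](mean_cst _ (last y s)); apply: le_mean => z.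
by apply: le01 => /negPn /trail_graph_rcons.
Qed.

(** The horizon [m] is chosen first, so that [v] is hit; then [n] is taken so
    large that [m] steps of error are negligible.  The choice of [n] does not
    depend on [g]: this is convergence of the traces in total variation. *)
Lemma graph_mean_source (u v : V) (eps : R) : 0 < eps ->
  \forall n \near \oo, forall g, (forall G, 0 <= g G <= 1) ->
    graph_mean g n u <= graph_mean g n v + eps.
Proof.
move=> e0; have e20 : 0 < eps / 2 by rewrite divr_gt0.
have [m] : exists m, miss v m u < eps / 2.
  have /cvgrPdist_lt/(_ _ e20)[N _ /(_ N (leqnn N))] := miss_cvg0 v u.
  by rewrite /= sub0r normrN ger0_norm ?miss_ge0// => h; exists N.
move=> mu.
have dm : last_edge_new n v *+ 2 *+ m @[n --> \oo] --> 0.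
  rewrite -(mul0rn _ m) -(mul0rn _ 2); do 2 apply: cvgMn.
  exact: last_edge_new_cvg0.
have dn0 n : 0 <= last_edge_new n v.
  by apply: walk_mean_ge0 => s; apply: mean_ge0.
have /cvgrPdist_lt/(_ _ e20)[N _ Nd] := dm.
exists N.+1 => // -[//|n]; rewrite /= ltnS => /Nd/=.
rewrite sub0r normrN ger0_norm; last by do 2 apply: mulrn_wge0.
move=> nd g g01.
have h01 y : 0 <= graph_mean g n.+1 y <= 1.
  rewrite walk_mean_ge0 ?walk_mean_le1// => s;
    by have /andP[] := g01 (trail_graph y s).
have d0 : 0 <= last_edge_new n v *+ 2 by apply: mulrn_wge0.
have sub y : graph_mean g n.+1 y <=
    mean (graph_mean g n.+1) y + last_edge_new n v *+ 2.
  by rewrite (last_edge_new_transitive n v y); exact: graph_mean_subharmonic.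
have := maximum_principle v m u h01 d0 sub; lra.
Qed.

(** All the sources are moved to one and the same vertex, where the guesses
    [g v] compete for a total mass of at most 1. *)
Lemma sum_graph_mean_le (B : seq V) (eps : R) (g : V -> embedded_graph V -> R) :
  0 < eps -> (forall v G, 0 <= g v G <= 1) ->
  (forall G, \sum_(v <- B) g v G <= 1) ->
  \forall n \near \oo,
    \sum_(v <- B) graph_mean (g v) n v <= 1 + eps *+ size B.
Proof.
move=> e0 g01 gB.
suff /(_ B) : forall C : seq V, \forall n \near \oo,
    \sum_(v <- C) graph_mean (g v) n v <=
    \sum_(v <- C) graph_mean (g v) n point + eps *+ size C.
  apply: filterS => n /le_trans; apply; rewrite lerD2r.
  by rewrite -walk_mean_sum; apply: walk_mean_le1 => s; exact: gB.
elim=> [|v C IHC].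
  by apply: nearW => n; rewrite !big_nil mulr0n addr0.
apply: filterS2 (graph_mean_source v point e0) IHC => n.
move=> /(_ (g v) (g01 v)) h1 h2.
by rewrite !big_cons /= mulrS; lra.
Qed.

End Recurrent.

(** * The law of the walk *)

(** The probability that the walk from [x] starts with the steps [s]. *)
Fixpoint path_weight (x : V) (s : seq V) : R :=
  if s is y :: s' then transition R H x y * path_weight y s' else 1.

Lemma path_weight_rcons x s y :
  path_weight x (rcons s y) =
  path_weight x s * transition R H (last x s) y.
Proof.
by elim: s x => [|z s IHs] x /=; rewrite ?mulr1 ?mul1r// IHs mulrA.
Qed.

Fixpoint walks (n : nat) (x : V) : seq (seq V) :=
  if n is n'.+1 then [seq y :: s | y <- nbrs x, s <- walks n' y]
  else [:: [::]].

Lemma walks_uniq n x : uniq (walks n x).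
Proof.
elim: n x => //= n IHn x; apply: allpairs_uniq_dep => //.
  exact: nbrs_uniq.
by move=> [y s] [z t] _ _ /= [-> ->].
Qed.

Lemma size_walks n x s : s \in walks n x -> size s = n.
Proof.
elim: n x s => [|n IHn] x s /=; first by rewrite inE => /eqP->.
by move=> /allpairsPdep[y [t [_ ty ->]]] /=; rewrite (IHn y).
Qed.

Lemma mem_walks x s : path H x s -> s \in walks (size s) x.
Proof.
elim: s x => [|y s IHs] x //= /andP[xy ys].
by apply/allpairsPdep; exists y, s; rewrite mem_nbrs IHs.
Qed.

Lemma walk_meanE n F x :
  walk_mean n F x = \sum_(s <- walks n x) path_weight x s * F s.
Proof.
elim: n F x => [|n IHn] F x; first by rewrite big_seq1 mul1r.
rewrite walk_meanS /= big_allpairs_dep /mean big_distrr /= big_seq.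
rewrite [RHS]big_seq; apply: eq_bigr => y; rewrite mem_nbrs => xy.
rewrite IHn big_distrr; apply: eq_bigr => s _ /=.
by rewrite /transition xy mulrA.
Qed.

Lemma connected_countable : connected_graph H -> countable [set: V].
Proof.
move=> hconn; pose U := \bigcup_n (last point @` [set` walks n point]).
apply: (@sub_countable _ _ _ U).
  apply: subset_card_le => y _.
  have [p [hp <-]] := hconn point y.
  by exists (size p) => //; exists p => //=; exact: mem_walks.
apply: bigcup_countable => // n _.
by apply: finite_set_countable; apply: finite_image; exact: finite_seq.
Qed.

End Averages.
Arguments walk_mean {R V} H n F x.

Section WalkLaw.
Local Open Scope ring_scope.
Context {R : realType} {V : pointedType}.
Variable H : sgraph V.
Context {d : measure_display} {Omega : measurableType d}.
Variables (P : V -> probability Omega R)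
          (X : nat -> {mfun Omega >-> discrete_space V}).
Hypothesis hdeg : finite_degree H.
Hypothesis hpos : forall x, exists y, H x y.
Hypothesis hcount : countable [set: V].
Hypothesis hwalk : simple_random_walk H P X.

Definition steps (n : nat) (w : Omega) : seq V := mkseq (fun i => X i.+1 w) n.

Lemma stepsS n w : steps n.+1 w = rcons (steps n w) (X n.+1 w).
Proof. by rewrite /steps mkseqS. Qed.

Lemma size_steps n w : size (steps n w) = n.
Proof. exact: size_mkseq. Qed.

Lemma last_steps n w : last (X 0%N w : V) (steps n w) = X n w.
Proof. by case: n => // n; rewrite stepsS last_rcons. Qed.

Lemma trace_graphE n w : trace_graph X n w = trail_graph (X 0%N w) (steps n w).
Proof.
elim: n => [|n IHn].
  congr EmbeddedGraph; apply/seteqP; split=> [x|x]/=.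
  - by move=> [i]; rewrite leqn0 => /eqP -> <-; rewrite mem_head.
  - by rewrite inE => /eqP ->; exists 0%N.
  - by move=> [].
  - by [].
move: IHn; rewrite /trace_graph /trail_graph stepsS.
rewrite trail_edges_rcons last_steps.
move=> [/seteqP[vs1 vs2] /seteqP[es1 es2]]; congr EmbeddedGraph; apply/seteqP.
  split=> x /=; rewrite -rcons_cons mem_rcons inE.
    move=> [i]; rewrite leq_eqVlt ltnS => /predU1P[-> <-|ni xi].
      by rewrite eqxx.
    by apply/orP; right; apply: vs1; exists i.
  move=> /predU1P[->|/vs2[i ni xi]]; first by exists n.+1.
  by exists i => //=; rewrite (leq_trans ni).
split=> x /=; rewrite mem_rcons inE.
  move=> [i]; rewrite ltnS leq_eqVlt => /predU1P[-> <-|ni xi].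
    by rewrite eqxx.
  by apply/orP; right; apply: es1; exists i.
move=> /predU1P[->|/es2[i ni xi]]; first by exists n.
by exists i => //=; rewrite (leq_trans ni).
Qed.

(** Every property of the first vertices is measurable because there are only
    countably many vertices, so that one can split according to the last one. *)
Lemma measurable_steps n (Q : V -> seq V -> Prop) :
  measurable [set w | Q (X 0%N w) (steps n w)].
Proof.
elim: n Q => [|n IHn] Q.
  rewrite -[X in measurable X]setTI.
  exact: (measurable_funP (X 0%N) measurableT [set x | Q x [::]]).
pose F x := [set w | X n.+1 w = x] `&`
            [set w | Q (X 0%N w) (rcons (steps n w) x)].
have -> : [set w | Q (X 0%N w) (steps n.+1 w)] = \bigcup_x F x.
  apply/seteqP; split=> w /=; rewrite stepsS.
    by move=> Qw; exists (X n.+1 w).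
  by move=> [x _ [/= ->]].
apply: countable_bigcupT_measurable => // x; apply: measurableI.
  rewrite -[X in measurable X]setTI.
  exact: (measurable_funP (X n.+1) measurableT [set x]).
exact: (IHn (fun x0 s => Q x0 (rcons s x))).
Qed.

Definition trajectory (v : V) (s : seq V) : set Omega :=
  [set w | X 0%N w = v /\ steps (size s) w = s].

Lemma measurable_trajectory v s : measurable (trajectory v s).
Proof. exact: (measurable_steps (size s) (fun x t => x = v /\ t = s)). Qed.

Lemma trajectoryE v s :
  trajectory v s =
  [set w | forall i, (i <= size s)%N -> X i w = nth v (v :: s) i].
Proof.
apply/seteqP; split=> w /=.
  move=> [X0 <-] [|i] //=; rewrite size_steps => si.
  by rewrite nth_mkseq.
move=> Xi; split; first exact: (Xi 0%N).
apply: (@eq_from_nth _ v); rewrite size_steps// => i si.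
by rewrite nth_mkseq// Xi.
Qed.

Lemma prob_trajectory v s : P v (trajectory v s) = (path_weight H v s)%:E.
Proof.
have [h0 hS] := hwalk.
elim/last_ind: s => [|s y IHs].
  rewrite -(h0 v); congr (P v _); apply/seteqP.
  by split=> w /=; [move=> []|].
rewrite path_weight_rcons EFinM -IHs !trajectoryE size_rcons.
have nl i : (i <= size s)%N -> nth v (v :: rcons s y) i = nth v (v :: s) i.
  by move=> si; rewrite -rcons_cons nth_rcons /= ltnS si.
rewrite hS nl// -rcons_cons nth_rcons /= ltnn eqxx.
rewrite (_ : nth v (v :: s) (size s) = last v s); last first.
  by rewrite (last_nth v).
congr (P v _ * _)%E; apply/seteqP.
by split=> w /= wi i si; rewrite wi// nl.
Qed.

Lemma measurable_step_fun n (F : V -> seq V -> R) :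
  measurable_fun [set: Omega] (fun w => (F (X 0%N w) (steps n w))%:E).
Proof.
apply/measurable_EFinP => _ Y mY; rewrite setTI.
exact: (measurable_steps n (fun x s => Y (F x s))).
Qed.

(** The finitely many trajectories charged by the walk are disjoint; keeping
    only their contribution bounds the integral from below. *)
Lemma walk_mean_le_integral n (F : V -> seq V -> R) v :
  (forall x s, 0 <= F x s) ->
  ((walk_mean H n (F v) v)%:E <= \int[P v]_w (F (X 0%N w) (steps n w))%:E)%E.
Proof.
move=> F0; rewrite walk_meanE// -sumEFin.
pose G s w := ((F v s)%:E * (\1_(trajectory v s) w)%:E)%E.
have mG s : measurable_fun [set: Omega] (G s).
  apply/measurable_EFinP; apply: measurable_funM; first exact: measurable_cst.
  exact/measurable_indicP/measurable_trajectory.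
have G0 s w : (0 <= G s w)%E by rewrite mule_ge0// lee_fin.
apply: (@le_trans _ _ (\int[P v]_w (\sum_(s <- walks H n v) G s w))%E).
  rewrite ge0_integral_sum//; apply: lee_sum => s _.
  rewrite ge0_integralZl_EFin//; last first.
    by apply/measurable_EFinP/measurable_indicP/measurable_trajectory.
  have -> : (\int[P v]_w (\1_(trajectory v s) w)%:E =
             (path_weight H v s)%:E)%E.
    rewrite integral_indic//; last exact: measurable_trajectory.
    rewrite setIT; exact: prob_trajectory.
  by rewrite EFinM muleC.
apply: ge0_le_integral => //.
- by move=> w _; apply: sume_ge0.
- exact: emeasurable_sum.
- exact: measurable_step_fun.
move=> w _; rewrite (bigID (pred1 (steps n w)))/= [X in (_ + X)%E]big_seq_cond.
rewrite [X in (_ + X)%E]big1 ?adde0; last first.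
  move=> s /andP[/size_walks ss /eqP sw]; rewrite /G indicE memNset ?mule0//.
  by move=> [_]; rewrite ss => ws; apply: sw.
have [sw|sw] := boolP (steps n w \in walks H n v); last first.
  rewrite big_seq_cond big_pred0 ?lee_fin// => s.
  by apply/negbTE/negP => /andP[ws /eqP se]; rewrite -se ws in sw.
rewrite -big_filter filter_pred1_uniq//; last exact: walks_uniq.
rewrite big_seq1 /G indicE; case: (boolP (w \in _)) => [/set_mem[<- _]|_].
  by rewrite mule1.
by rewrite mule0 lee_fin.
Qed.

(** Both sides are additive in [F] and agree on the constant 1, so the lower
    bound for [1 - F] is the upper bound for [F]. *)
Lemma integral_walk_mean n (F : V -> seq V -> R) v :
  (forall x s, 0 <= F x s <= 1) ->
  (\int[P v]_w (F (X 0%N w) (steps n w))%:E = (walk_mean H n (F v) v)%:E)%E.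
Proof.
move=> F01; pose F' x s := 1 - F x s.
have F0 x s : 0 <= F x s by have /andP[] := F01 x s.
have F'0 x s : 0 <= F' x s by rewrite subr_ge0; have /andP[] := F01 x s.
have h := walk_mean_le_integral n v F0.
have h' := walk_mean_le_integral n v F'0.
have sum1 : (\int[P v]_w (F (X 0%N w) (steps n w))%:E +
             \int[P v]_w (F' (X 0%N w) (steps n w))%:E = 1)%E.
  rewrite -ge0_integralD//; try exact: measurable_step_fun.
  - rewrite (_ : (fun _ => _) = cst 1%E).
      rewrite integral_cst// mul1e; exact: probability_setT.
    by apply/funext => w /=; rewrite -EFinD addrC subrK.
  - by move=> w _; rewrite lee_fin.
  - by move=> w _; rewrite lee_fin.
have wsum : walk_mean H n (F v) v + walk_mean H n (F' v) v = 1.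
  rewrite -walk_meanD -[RHS](walk_mean_cst hdeg hpos n 1 v).
  by apply: eq_walk_mean => s; rewrite addrC subrK.
move: h h' sum1; set a := (\int[P v]_w _)%E; set b := (\int[P v]_w _)%E.
case: a => [a| |]; case: b => [b| |] //=.
rewrite !lee_fin -EFinD => h h' [ab]; congr _%:E; lra.
Qed.

Lemma return_cvg0 v : recurrent P X ->
  walk_mean H m (fun s => (v \notin s)%:R) v @[m --> \oo] --> (0 : R).
Proof.
move=> hrec; pose E m := [set w | v \notin steps m w].
have mE m : measurable (E m).
  exact: (measurable_steps m (fun _ s => v \notin s)).
have EP m : P v (E m) = (walk_mean H m (fun s => (v \notin s)%:R) v)%:E.
  rewrite -(@integral_walk_mean m (fun _ s => (v \notin s)%:R)); last first.
    by move=> x s; case: (_ \notin _); rewrite ?lexx ?ler01.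
  rewrite -[E m]setIT -integral_indic//; apply: eq_integral => w _.
  rewrite indicE; congr ((nat_of_bool _)%:R)%:E.
  by apply/idP/idP => [/set_mem|h]; last exact/mem_set.
have mI : measurable (\bigcap_m E m) by exact: bigcap_measurable.
have PI : P v (\bigcap_m E m) = 0%E.
  apply/negligibleP => //; apply: negligibleS (hrec v) => w wE [n [n0 nv]].
  have := wE n I; rewrite /E /= => /negP; apply.
  by case: n n0 nv => // n _ <-; rewrite stepsS mem_rcons mem_head.
have : (P v \o E) x @[x --> \oo] --> P v (\bigcap_m E m).
  apply: nonincreasing_cvg_mu => //.
    by rewrite (le_lt_trans (probability_le1 _ _))// ltry.
  apply/nonincreasing_seqP => m; apply/subsetPset => w; rewrite /E /= stepsS.
  by rewrite mem_rcons inE negb_or => /andP[].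
rewrite PI => /fine_cvgP[_]; apply: cvg_trans; apply: near_eq_cvg.
by apply: nearW => m; rewrite /= EP.
Qed.

Lemma success_probE (Phi : estimator R V) n v :
  success_prob P X Phi n v =
  (graph_mean H (fun G => fine (Phi G [set v])) n v)%:E.
Proof.
rewrite /graph_mean.
rewrite -(@integral_walk_mean n
  (fun x s => fine (Phi (trail_graph x s) [set v]))).
  by apply: eq_integral => w _; rewrite fineK ?trace_graphE// fin_num_measure.
move=> x s; rewrite fine_ge0//= -lee_fin fineK ?fin_num_measure//.
exact: probability_le1.
Qed.

End WalkLaw.

(** * Amnesia *)

Lemma connected_infinite_neighbour (V : pointedType) (H : sgraph V) :
  infinite_set [set: V] -> connected_graph H -> forall x, exists y, H x y.
Proof.
move=> hinf hconn x.
have [y yx] : exists y, y != x.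
  apply: contrapT => nyx; apply: hinf.
  apply: (sub_finite_set _ (finite_set1 x)).
  by move=> y _ /=; apply: contrapT => yx; apply: nyx; exists y; apply/eqP.
have [[|z p] [/= pp ly]] := hconn x y.
  by rewrite ly eqxx in yx.
by exists z; case/andP: pp.
Qed.

Lemma sum_point_masses_le1 (R : realType) (V : pointedType)
    (mu : probability (discrete_space V) R) (B : seq V) :
  uniq B -> (\sum_(v <- B) fine (mu [set v]) <= 1)%R.
Proof.
move=> uB; rewrite -lee_fin -sumEFin.
rewrite (eq_bigr (fun v => mu [set v])); last first.
  by move=> v _; rewrite fineK// fin_num_measure.
rewrite (_ : (\sum_(v <- B) mu [set v])%E = mu [set` B]).
  exact: probability_le1.
elim: B uB => [|v B IHB] /=.
  by move=> _; rewrite big_nil set_nil; apply/esym; exact: measure0.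
move=> /andP[vB uB]; rewrite big_cons IHB//.
have -> : [set` v :: B] = [set v] `|` [set` B].
  apply/seteqP; split=> x /=; rewrite inE.
    by move=> /predU1P[->|xB]; [left|right].
  by move=> [->|->]; rewrite ?eqxx ?orbT.
apply/esym; apply: measureU => //.
by apply/seteqP; split=> // x [/= -> xB]; rewrite xB in vB.
Qed.

Theorem theorem1p3 (R : realType) (V : pointedType) (H : sgraph V)
    (d : measure_display) (Omega : measurableType d)
    (P : V -> probability Omega R)
    (X : nat -> {mfun Omega >-> discrete_space V})
    (hinf : infinite_set [set: V])
    (hconn : connected_graph H)
    (htrans : vertex_transitive H)
    (hdeg : finite_degree H)
    (hwalk : simple_random_walk H P X)
    (hrec : recurrent P X) :
  amnesiac P X.
Proof.
have hpos := connected_infinite_neighbour hinf hconn.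
have hcount := connected_countable hdeg hconn.
have hret v := return_cvg0 hdeg hpos hcount hwalk v hrec.
move=> Phi.
have uE n v := success_probE hdeg hpos hcount hwalk Phi n v.
set u := (fun n => _).
have u0 n : (0 <= u n)%E.
  apply: le_ereal_inf_tmp => _ [v _ <-]; rewrite uE lee_fin.
  by apply: (walk_mean_ge0 hdeg hpos) => s; exact: fine_ge0.
have small (e : R) : (0 < e)%R -> \forall n \near \oo, (u n <= e%:E)%E.
  move=> e0; pose g v G := fine (Phi G [set v]).
  have g01 v G : (0 <= g v G <= 1)%R.
    rewrite fine_ge0//= -lee_fin fineK ?fin_num_measure//.
    exact: probability_le1.
  (* [K] vertices with [1 <= K * (e / 2)]: if all of them were recovered with
     probability above [e], the sum would exceed [K * e >= 1 + K * (e / 2)]. *)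
  pose K := (Num.truncn (2 / e)).+1.
  have [B _ KB] := @infinite_set_fset V setT K hinf.
  have e20 : (0 < e / 2)%R by rewrite divr_gt0.
  have gB G := sum_point_masses_le1 (Phi G) (fset_uniq B).
  have := sum_graph_mean_le hdeg hpos hconn hret htrans e20 g01 gB.
  apply: filterS => n; apply: contraPP => /negP; rewrite -ltNge => un.
  have gn v : (e < graph_mean H (g v) n v)%R.
    rewrite -lte_fin -uE; apply: (lt_le_trans un); apply: ereal_inf_lbound.
    by exists v.
  apply/negP; rewrite -ltNge.
  have B1 : (1 <= e / 2 *+ size B)%R.
    rewrite -mulr_natr -ler_pdivrMl// invf_div mulr1.
    apply: (@le_trans _ _ K%:R%R); last by rewrite ler_nat.
    by apply: ltW; rewrite truncnS_gt.
  apply: (@le_lt_trans _ _ (\sum_(v <- B) e)%R).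
    rewrite big_const_seq count_predT iter_addr addr0.
    by rewrite [X in (_ <= X *+ _)%R](splitr e) mulrnDl lerD2r.
  apply: ltr_sum => //; rewrite has_predT.
  exact: leq_trans KB.
apply: (cvg_limn_einf_sup _).2.
have ufin : \forall n \near \oo, u n \is a fin_num.
  apply: filterS (small 1%R ltr01) => n un.
  by rewrite ge0_fin_numE// (le_lt_trans un)// ltry.
apply: cvg_EFin => //; apply/cvgrPdist_le => e e0.
apply: filterS2 ufin (small e e0) => n fn un.
by rewrite /= sub0r normrN ger0_norm ?fine_ge0// -lee_fin fineK.
Qed.
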